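(* Let $G$ be a hypergraph with vertex set $\{1,\dots,n\}$ such that $P|G\rangle=|G\rangle$ for every cut set $T=\{k_1,\dots,k_m\}$ (every $m<n$) and every permutation operator $P$ that maps the qubits in $T$ to $\mathcal I=\{1,\dots,m\}$. Then, for each $m<n$, the partial transposes $\rho_G^{\tau_T}$ with respect to all cut sets $T$ of length $m$ have equal sets of eigenvalues; that is, for any two cut sets $T,T'$ with $|T|=|T'|=m$, the matrices $\rho_G^{\tau_T}$ and $\rho_G^{\tau_{T'}}$ have the same set of eigenvalues.
   Context: $[2^n]=\{0,1,\dots,2^n-1\}$, and $\mathrm{bin}(i)=(i_1,\dots,i_n)\in\{0,1\}^n$ is the $n$-term binary representation of $i$ (most significant digit first). $|0\rangle,|1\rangle$ is the standard basis of $\mathcal H_2=\mathbb C^2$, and $|\mathrm{bin}(i)\rangle=|i_1\rangle\otimes\cdots\otimes|i_n\rangle$. A hypergraph $G=(V(G),E(G))$ has vertex set $V(G)=\{1,\dots,n\}$ and a set $E(G)$ of hyperedges, each a subset of $V(G)$. For $e\subseteq V(G)$, $Z_e$ is the linear operator on $\mathcal H_2^{\otimes n}$ with $Z_e|\mathrm{bin}(i)\rangle=-|\mathrm{bin}(i)\rangle$ if $i_v=1$ for all $v\in e$, and $Z_e|\mathrm{bin}(i)\rangle=|\mathrm{bin}(i)\rangle$ otherwise. With $|+\rangle=\frac1{\sqrt2}(|0\rangle+|1\rangle)$, the hypergraph state is $|G\rangle=\left(\prod_{e\in E(G)}Z_e\right)|+\rangle^{\otimes n}$. Let $f:\{0,1\}^n\to\{0,1\}$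 be the unique Boolean function with $|G\rangle=\frac1{\sqrt{2^n}}\sum_{i\in[2^n]}(-1)^{f(\mathrm{bin}(i))}|\mathrm{bin}(i)\rangle$. The density matrix of $|G\rangle$ is $$\rho_G=|G\rangle\langle G|=\frac1{2^n}\sum_{i\in[2^n]}\sum_{j\in[2^n]}(-1)^{f(\mathrm{bin}(i))+f(\mathrm{bin}(j))}|i_1\dots i_n\rangle\langle j_1\dots j_n|.$$ A cut set is a set $T=\{k_1,\dots,k_m\}\subset\{1,\dots,n\}$ of $m<n$ distinct qubit indices; $m$ is its length. The partial transpose of $\rho_G$ with respect to $T$ is $$\rho_G^{\tau_T}=\frac1{2^n}\sum_{i\in[2^n]}\sum_{j\in[2^n]}(-1)^{f(\mathrm{bin}(i))+f(\mathrm{bin}(j))}|a_1\dots a_n\rangle\langle b_1\dots b_n|,$$ where $(a_v,b_v)=(j_v,i_v)$ if $v\in T$ and $(a_v,b_v)=(i_v,j_v)$ if $v\notin T$ (that is, the indices $i_v$ and $j_v$ are interchanged exactly at the positions $v\in T$). A permutation operator mapping the qubits in $T$ to $\mathcal I=\{1,\dots,m\}$ is a linear operator $P$ on $\mathcal H_2^{\otimes n}$ for which there is a permutation $\pi$ of $\{1,\dots,n\}$ with $\pi(k_r)=r$ for $r=1,\dots,m$, such that $P$ permutes the tensor factors according to $\pi$: $P(|i_1\rangle\otimes\cdots\otimes|i_n\rangle)=|i_{\pi^{-1}(1)}\rangle\otimes\cdots\otimes|i_{\pi^{-1}(n)}\rangle$ for all $i_1,\dots,i_n\in\{0,1\}$.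 *)

(* Defs.v *)
From mathcomp Require Import all_boot all_order all_fingroup all_algebra.
From mathcomp Require Import spectral.
From mathcomp Require Export reals complex.

Set Implicit Arguments.
Unset Strict Implicit.
Unset Printing Implicit Defensive.

Import GRing.Theory Num.Theory.
Local Open Scope ring_scope.
Local Open Scope sesquilinear_scope.

(* Vertices and qubits 1, ..., n are the ordinals 0, ..., n-1 of 'I_n. *)
Notation bits n := {ffun 'I_n -> bool}.

(* Most significant digit first. *)
Definition bin n (i : 'I_(2 ^ n)) : bits n :=
  [ffun v : 'I_n => odd (i %/ 2 ^ (n - v.+1))].

Section States.
Variables (C : numClosedFieldType) (n : nat).

(* The n-fold tensor power of C^2 is 'cV[C]_(2 ^ n), its linear operators are
   'M[C]_(2 ^ n); [tensor u] is the Kronecker product u_1 (x) ... (x) u_n. *)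
Definition tensor (u : 'I_n -> 'cV[C]_2) : 'cV[C]_(2 ^ n) :=
  \col_i \prod_(v < n) u v (inord (bin i v)) 0.

Definition qubit (b : bool) : 'cV[C]_2 := delta_mx (inord b) 0.

Definition plus : 'cV[C]_2 := (sqrtC 2)^-1 *: (qubit false + qubit true).

Definition ket (b : bits n) : 'cV[C]_(2 ^ n) := tensor (fun v => qubit (b v)).

Definition bra (b : bits n) : 'rV[C]_(2 ^ n) := (ket b)^t*.

(* The operator Z_e. Diagonal because |bin(i)> is the i-th vector of the canonical basis of
   'cV[C]_(2 ^ n), see [ket_bin] and [CZ_ket]. *)
Definition CZ (e : {set 'I_n}) : 'M[C]_(2 ^ n) :=
  diag_mx (\row_i (if [forall v in e, bin i v] then -1 else 1)).

(* A hypergraph on {1, ..., n} is given by its set of hyperedges. The CZ e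
   commute, so the order of the product is irrelevant. *)
Definition hgstate (E : {set {set 'I_n}}) : 'cV[C]_(2 ^ n) :=
  (\prod_(e in E) CZ e) *m tensor (fun _ => plus).

Definition density (E : {set {set 'I_n}}) : 'M[C]_(2 ^ n) :=
  hgstate E *m (hgstate E)^t*.

(* Bit string equal to y at the positions in T and to x elsewhere. *)
Definition swap_in (T : {set 'I_n}) (x y : bits n) : bits n :=
  [ffun v => if v \in T then y v else x v].

(* Partial transpose of an arbitrary operator
   A = \sum_(i, j) A i j |bin i><bin j|; see [ptranspose_density]. *)
Definition ptranspose (T : {set 'I_n}) (A : 'M[C]_(2 ^ n)) : 'M[C]_(2 ^ n) :=
  \sum_i \sum_j A i j *:
    (ket (swap_in T (bin i) (bin j)) *m bra (swap_in T (bin j) (bin i))).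

(* P is a permutation operator mapping the qubits in T = {k_1, ..., k_m} to
   {1, ..., m}, for some enumeration k_1, ..., k_m of T (not necessarily
   increasing). *)
Definition perm_operator (T : {set 'I_n}) (P : 'M[C]_(2 ^ n)) : Prop :=
  exists (k : #|T|.-tuple 'I_n) (s : 'S_n),
    [/\ [set v in k] = T,
        forall r : 'I_#|T|, s (tnth k r) = r :> nat
      & forall b : bits n, P *m ket b = ket [ffun v => b ((s^-1)%g v)]].

(* f is the Boolean function of the hypergraph state of E. *)
Definition sign_function (E : {set {set 'I_n}}) (f : {ffun bits n -> bool}) :=
  hgstate E = (sqrtC (2 ^+ n))^-1 *: \sum_i (-1) ^+ f (bin i) *: ket (bin i).

End States.

Arguments perm_operator {C n}.

Lemma bin_inj n : injective (@bin n).
Proof.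
have step k : forall a b : nat, (a < 2 ^ k)%N -> (b < 2 ^ k)%N ->
    (forall j, (j < k)%N -> odd (a %/ 2 ^ j) = odd (b %/ 2 ^ j)) -> a = b.
  elim: k => [|k IHk] a b.
    by rewrite expn0 !ltnS !leqn0 => /eqP-> /eqP->.
  move=> lta ltb eqab.
  have ab2 : a./2 = b./2.
    apply: IHk => [||j ltj].
    - by rewrite -divn2 ltn_divLR // mulnC -expnS.
    - by rewrite -divn2 ltn_divLR // mulnC -expnS.
    - by rewrite -!divn2 -!divnMA -expnS; apply: eqab.
  rewrite -(odd_double_half a) -(odd_double_half b) ab2.
  by have := eqab 0 isT; rewrite expn0 !divn1 => ->.
move=> i j eqij; apply/val_inj/(step n) => //= l ltl.
have lt1 : (n - l.+1 < n)%N by rewrite ltn_subrL (leq_trans _ ltl).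
have := congr1 (fun b : bits n => b (Ordinal lt1)) eqij.
by rewrite !ffunE /= subnSK // subKn // ltnW.
Qed.

Lemma bin_bij n : bijective (@bin n).
Proof.
by apply: inj_card_bij (@bin_inj n) _; rewrite card_ffun card_bool !card_ord.
Qed.

Section Facts.
Variables (C : numClosedFieldType) (n : nat).

Lemma eq_inord_bool (b c : bool) : (inord b == inord c :> 'I_2) = (b == c).
Proof. by rewrite -val_eqE; case: b c => [] []; rewrite /= !inordK. Qed.

Lemma ket_bin (i : 'I_(2 ^ n)) : ket C (bin i) = delta_mx i 0.
Proof.
apply/colP => j; rewrite !mxE eqxx andbT; have [->|neq] := eqVneq j i.
  by rewrite big1 // => v _; rewrite mxE !eqxx.
have /existsP[v neqv] : [exists v, bin j v != bin i v].
  apply: contraNT neq; rewrite negb_exists => /forallP eqv.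
  by apply/eqP/bin_inj/ffunP => v; apply/eqP; have := eqv v; rewrite negbK.
by rewrite (bigD1 v) //= mxE eq_inord_bool (negPf neqv) mul0r.
Qed.

Lemma CZ_ket (e : {set 'I_n}) (i : 'I_(2 ^ n)) :
  CZ C e *m ket C (bin i) =
  if [forall v in e, bin i v] then - ket C (bin i) else ket C (bin i).
Proof.
rewrite ket_bin; apply/colP => j; rewrite mul_diag_mx !mxE eqxx andbT.
have [->|neq] := eqVneq j i.
  by case: ifP; rewrite !mxE !eqxx mulr1.
by case: ifP => _; rewrite mulr0; case: ifP => _; rewrite !mxE (negPf neq) ?oppr0.
Qed.

Let amp : C := (sqrtC (2 ^+ n))^-1.

Lemma prod_diag_mx (I : Type) (r : seq I) (Q : pred I) (m : nat)
    (d : I -> 'I_m -> C) :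
  \prod_(e <- r | Q e) diag_mx (\row_j d e j) =
  diag_mx (\row_j \prod_(e <- r | Q e) d e j).
Proof.
elim: r => [|e r IHr].
  rewrite big_nil -[1]/(1%:M) -diag_const_mx; congr diag_mx.
  by apply/rowP => j; rewrite !mxE big_nil.
rewrite big_cons IHr; case: ifP => Qe; last first.
  by congr diag_mx; apply/rowP => j; rewrite !mxE big_cons Qe.
rewrite -[_ * _]/(_ *m _) mulmx_diag; congr diag_mx.
by apply/rowP => j; rewrite !mxE big_cons Qe.
Qed.

Lemma hgstateE (E : {set {set 'I_n}}) i :
  hgstate C E i 0 =
  amp * (-1) ^+ odd #|[set e in E | [forall v in e, bin i v]]|.
Proof.
rewrite /hgstate /CZ prod_diag_mx mul_diag_mx !mxE mulrC; congr (_ * _).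
  rewrite (eq_bigr (fun=> (sqrtC 2)^-1)) => [|v _].
    by rewrite prodr_const card_ord /amp rootCX ?ler0n // exprVn.
  rewrite !mxE !eqxx !andbT !eq_inord_bool.
  by case: (bin i v); rewrite ?addr0 ?add0r mulr1.
rewrite signr_odd -prodr_const big_mkcond [in RHS]big_mkcond /=.
by apply: eq_bigr => e _; rewrite inE; case: (e \in E).
Qed.

Lemma sum_ketE (c : 'I_(2 ^ n) -> C) i :
  (\sum_j c j *: ket C (bin j)) i 0 = c i.
Proof.
rewrite summxE (bigD1 i) //= ket_bin !mxE !eqxx mulr1 big1 ?addr0 // => j neq.
by rewrite ket_bin !mxE eq_sym (negPf neq) mulr0.
Qed.

Lemma sign_functionP (E : {set {set 'I_n}}) (f : {ffun bits n -> bool}) :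
  sign_function C E f <->
  forall i, hgstate C E i 0 = amp * (-1) ^+ f (bin i).
Proof.
split=> [-> i|eqf]; last first.
  apply/colP => i; rewrite eqf mxE; congr (_ * _); apply/esym.
  exact: (sum_ketE (fun j => (-1) ^+ f (bin j))).
by rewrite mxE; congr (_ * _); exact: (sum_ketE (fun j => (-1) ^+ f (bin j))).
Qed.

Lemma sign_function_unique (E : {set {set 'I_n}}) :
  exists! f, sign_function C E f.
Proof.
exists [ffun b : bits n => odd #|[set e in E | [forall v in e, b v]]|].
split=> [|f /sign_functionP eqf].
  by apply/sign_functionP => i; rewrite hgstateE ffunE.
have [g _ binK] := bin_bij n; apply/ffunP => b; rewrite -(binK b) ffunE.
have amp0 : amp != 0.
  by rewrite invr_eq0 sqrtC_eq0 expf_neq0 // pnatr_eq0.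
have := eqf (g b); rewrite hgstateE => /(mulfI amp0).
exact: signr_inj.
Qed.

Lemma ptranspose_density (E : {set {set 'I_n}}) (f : {ffun bits n -> bool})
    (T : {set 'I_n}) : sign_function C E f ->
  ptranspose T (density C E) =
  (2 ^+ n)^-1 *: \sum_i \sum_j (-1) ^+ (f (bin i) + f (bin j)) *:
    (ket C (swap_in T (bin i) (bin j)) *m bra C (swap_in T (bin j) (bin i))).
Proof.
move=> /sign_functionP eqf; rewrite scaler_sumr; apply: eq_bigr => i _.
rewrite scaler_sumr; apply: eq_bigr => j _; rewrite scalerA; congr (_ *: _).
have -> : density C E i j = hgstate C E i 0 * (hgstate C E j 0)^*.
  have trE : (hgstate C E)^T 0 j = hgstate C E j 0 by rewrite [LHS]mxE.
  by rewrite [LHS]mxE big_ord1 [X in _ * X = _]mxE trE.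
rewrite !eqf rmorphM rmorph_sign mulrACA -exprD.
congr (_ * _).
have amp_ge0 : 0 <= amp by rewrite invr_ge0 sqrtC_ge0 exprn_ge0 ?ler0n.
rewrite [X in _ * X](_ : _ = amp); last exact: CrealP (ger0_real amp_ge0).
by rewrite -expr2 exprVn sqrtCK.
Qed.

End Facts.

(* Main.v *)
(** A permutation of the qubits that sends T onto T' acts on the computational
    basis by a permutation matrix. It fixes the state, hence the density matrix,
    and therefore conjugates the partial transpose over T into the one over T'.
    Invariance under every qubit permutation is the instance of the hypothesis
    at the empty cut set. *)
Require Import Defs.
From mathcomp Require Import all_boot all_order all_fingroup all_algebra.
From mathcomp Require Import reals complex.

Set Implicit Arguments.
Unset Strict Implicit.
Unset Printing Implicit Defensive.

Import GRing.Theory Num.Theory.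
Local Open Scope ring_scope.

(** List [A] followed by its complement, and [B] likewise. Sending each entry of the first list to
    the entry at the same position in the second gives a permutation, and the initial blocks match
    because their lengths agree. *)
Lemma exists_perm_imset (T : finType) (A B : {set T}) :
  #|A| = #|B| -> exists s : {perm T}, s @: A = B.
Proof.
move=> cardAB; pose e (D : {set T}) := enum D ++ enum (~: D).
have mem_e D x : x \in e D by rewrite mem_cat !mem_enum inE orbN.
have size_e D : size (e D) = #|T| by rewrite size_cat -!cardE cardsC.
have uniq_e D : uniq (e D).
  rewrite cat_uniq !enum_uniq andbT /=; apply/hasPn => x.
  by rewrite !mem_enum inE.
have lt_index x : (index x (e A) < size (e B))%N.
  by rewrite size_e -(size_e A) index_mem.
pose f x := nth x (e B) (index x (e A)).
have f_inj : injective f.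
  (* The default in [f] varies with the argument, so the two are made equal first; [lt_index] shows
     that it is never returned. *)
  move=> x y; rewrite /f (set_nth_default x y) // => /eqP.
  by rewrite nth_uniq // => /eqP/index_inj; apply.
exists (perm f_inj); apply/eqP.
rewrite eqEcard card_imset; last exact: perm_inj.
rewrite cardAB leqnn andbT; apply/subsetP => _ /imsetP[x Ax ->].
have xA : x \in enum A by rewrite mem_enum.
rewrite permE /f index_cat xA.
have ltxB : (index x (enum A) < size (enum B))%N.
  by rewrite -cardE -cardAB cardE index_mem.
by rewrite nth_cat ltxB -mem_enum mem_nth.
Qed.

(** The matrices are conjugate by a permutation matrix, so permuting coordinates by [p^-1] or [p]
    carries the row eigenvectors of one to those of the other. *)
Lemma eigenvalue_row_col_perm (F : fieldType) (N : nat) (p : 'S_N)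
    (A B : 'M[F]_N) :
  (forall i j, A i j = B (p i) (p j)) -> eigenvalue A =i eigenvalue B.
Proof.
move=> eqAB a; apply/idP/idP => /eigenvalueP[v vE v0]; apply/eigenvalueP.
- exists (col_perm p^-1 v).
    apply/rowP => j; rewrite !mxE; have /rowP/(_ (p^-1 j)%g) := vE.
    rewrite !mxE => <-; rewrite [RHS](reindex_perm p^-1) /=.
    by apply: eq_bigr => i _; rewrite !mxE eqAB !permKV.
  apply: contraNneq v0 => /rowP pv0; apply/eqP/rowP => j.
  by have := pv0 (p j); rewrite !mxE permK.
exists (col_perm p v).
  apply/rowP => j; rewrite !mxE; have /rowP/(_ (p j)) := vE.
  rewrite !mxE => <-; rewrite [RHS](reindex_perm p) /=.
  by apply: eq_bigr => i _; rewrite !mxE eqAB.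
apply: contraNneq v0 => /rowP pv0; apply/eqP/rowP => j.
by have := pv0 (p^-1 j)%g; rewrite !mxE permKV.
Qed.

Definition permute_bits n (s : 'S_n) (b : bits n) : bits n :=
  [ffun v => b ((s^-1)%g v)].

Lemma permute_bits_inj n (s : 'S_n) : injective (permute_bits s).
Proof.
move=> b c /ffunP eqbc; apply/ffunP => v.
by have := eqbc (s v); rewrite !ffunE permK.
Qed.

Lemma permute_bits_swap_in n (s : 'S_n) (T : {set 'I_n}) (b c : bits n) :
  permute_bits s (swap_in T b c) =
  swap_in (s @: T) (permute_bits s b) (permute_bits s c).
Proof.
apply/ffunP => v; rewrite !ffunE.
by rewrite -[in v \in _](permKV s v) mem_imset //; exact: perm_inj.
Qed.

Lemma exists_index_perm n (s : 'S_n) :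
  exists p : 'S_(2 ^ n), forall i, bin (p i) = permute_bits s (bin i).
Proof.
have [g binK gK] := bin_bij n.
have p_inj : injective (fun i => g (permute_bits s (bin i))).
  by move=> i j /(can_inj gK)/permute_bits_inj/bin_inj.
by exists (perm p_inj) => i; rewrite permE gK.
Qed.

Section QubitPermutation.
Variables (C : numClosedFieldType) (n : nat) (s : 'S_n) (p : 'S_(2 ^ n)).
Hypothesis bin_p : forall i, bin (p i) = permute_bits s (bin i).

Lemma ketE (b : bits n) i : ket C b i 0 = (b == bin i)%:R.
Proof.
have [g _ gK] := bin_bij n.
by rewrite -(gK b) ket_bin !mxE eqxx andbT (inj_eq (@bin_inj n)) eq_sym.
Qed.

(** With indicators in place of kets and bras, both sums can be reindexed by [p]. *)
Lemma ptransposeE (T : {set 'I_n}) (A : 'M[C]_(2 ^ n)) i j :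
  ptranspose T A i j =
  \sum_k \sum_l A k l * ((swap_in T (bin k) (bin l) == bin i)%:R *
                         (swap_in T (bin l) (bin k) == bin j)%:R).
Proof.
rewrite summxE; apply: eq_bigr => k _; rewrite summxE; apply: eq_bigr => l _.
rewrite mxE; congr (_ * _); rewrite mxE big_ord1 ketE; congr (_ * _).
by rewrite [LHS]mxE [X in Num.conj X]mxE ketE rmorph_nat.
Qed.

Lemma ptranspose_perm (T : {set 'I_n}) (A : 'M[C]_(2 ^ n)) :
  (forall i j, A (p i) (p j) = A i j) ->
  forall i j, ptranspose T A i j = ptranspose (s @: T) A (p i) (p j).
Proof.
move=> Ap i j; rewrite !ptransposeE [RHS](reindex_perm p).
apply: eq_bigr => k _; rewrite [RHS](reindex_perm p).
apply: eq_bigr => l _; rewrite Ap !bin_p -!permute_bits_swap_in.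
by rewrite !(inj_eq (@permute_bits_inj n s)).
Qed.

(** An empty cut set puts no constraint on [s]. The inverse appears because [perm_mx] acts by
    [row_perm]: [perm_mx p^-1] sends the basis vector of index [i] to that of index [p i]. *)
Lemma perm_operator_perm_mx : perm_operator set0 (perm_mx p^-1 : 'M[C]_(2 ^ n)).
Proof.
rewrite /perm_operator cards0; exists [tuple], s; split.
- by apply/setP => v; rewrite !inE.
- by case.
move=> b; apply/colP => i.
rewrite -row_permE mxE !ketE -[in RHS](permKV p i) bin_p.
by rewrite -/(permute_bits s b) (inj_eq (@permute_bits_inj n s)).
Qed.

Lemma density_perm (E : {set {set 'I_n}}) :
  perm_mx p^-1 *m hgstate C E = hgstate C E ->
  forall i j, density C E (p i) (p j) = density C E i j.
Proof.
move=> fixE; have stE i : hgstate C E (p i) 0 = hgstate C E i 0.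
  by rewrite -[in LHS]fixE -row_permE mxE permK.
move=> i j; rewrite ![density _ _ _ _]mxE !big_ord1 stE; congr (_ * _).
by rewrite [LHS]mxE [RHS]mxE ![_^T _ _]mxE stE.
Qed.

End QubitPermutation.

Theorem theorem5 (R : realType) (n : nat) (E : {set {set 'I_n}})
    (hE : forall (T : {set 'I_n}) (P : 'M[R[i]]_(2 ^ n)),
      (#|T| < n)%N -> perm_operator T P ->
      P *m hgstate R[i] E = hgstate R[i] E)
    (m : nat) (hm : (m < n)%N) (T T' : {set 'I_n})
    (hT : #|T| = m) (hT' : #|T'| = m) :
  eigenvalue (ptranspose T (density R[i] E)) =i
  eigenvalue (ptranspose T' (density R[i] E)).
Proof.
have [s <-] : exists s : 'S_n, s @: T = T'.
  by apply: exists_perm_imset; rewrite hT hT'.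
have [p bin_p] := exists_index_perm s.
apply: (eigenvalue_row_col_perm (p := p)); apply: ptranspose_perm => //.
apply: density_perm; apply: (hE set0); last exact: perm_operator_perm_mx bin_p.
(* The empty set is a legitimate cut set: [m < n] forces [0 < n]. *)
by rewrite cards0 (leq_trans _ hm).
Qed.
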